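(* Let $M$ be a connected singular $(G,X)$-manifold and let $S$ be a skeletal subset of $M$ containing $\mathrm{Sing}(M)$, such that $M\setminus S$ is semi-locally simply connected. Then $\widetilde M^S$ admits a unique a.e. $(G,X)$-structure such that the natural projection $\widetilde M^S\to M$ is an a.e. $(G,X)$-morphism. Furthermore, the Galois group $\Gamma(\widetilde M^S/M)$ acts on $\widetilde M^S$ by a.e. $(G,X)$-morphisms.
   Context: All topological spaces are Hausdorff, locally path connected and first countable. $(G,X)$ is an analytical structure: $X$ is a connected, locally connected, Hausdorff topological space and $G$ is a group acting faithfully on $X$ by homeomorphisms such that for all $\phi_1,\phi_2\in G$ and every nonempty open $U\subset X$, if $\phi_1$ and $\phi_2$ agree on $U$ they agree on $X$. A $(G,X)$-atlas is an atlas of charts valued in open subsets of $X$ whose changes of charts are locally restrictions of elements of $G$; a $(G,X)$-morphism is a map which in such charts is locally the restriction of an element of $G$. A subset $U$ of a space $M$ is portly if it is open, dense and locally connected in $M$ (i.e. $W\cap U$ is connected for every open connected $W\subset M$); a subset is skeletal if its complement is portly. An almost everywhere (a.e.) $(G,X)$-structure on $M$ is given by a $(G,X)$-atlas on some portly subset of $M$; any such structure has a maximal extension (extending both the portly domain and the atlas), and a.e. structures are identified with their maximal extensions. A singular $(G,X)$-manifold is a locally connected Hausdorff second countable space $M$ endowed with a maximal a.e. $(G,X)$-structure; $\mathrm{Reg}(M)$ is the portly subset on which this maximal structure is defined, and $\mathrm{Sing}(M)=M\setminus\mathrm{Reg}(M)$. An a.e. $(G,X)$-morphism $f:M\to N$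 is a continuous map for which there exist portly subsets $U\subset\mathrm{Reg}(M)$ and $V\subset\mathrm{Reg}(N)$ such that $f$ restricts to a $(G,X)$-morphism $U\to V$. A spread $p:X\to Y$ is a continuous map such that the connected components of preimages $p^{-1}(U)$ of open subsets $U\subset Y$ generate the topology of $X$. It is complete if for every $y\in\overline{p(X)}$ and every inclusion-increasing assignment $\chi$ associating to each open connected neighborhood $U$ of $y$ a connected component $\chi(U)$ of $p^{-1}(U)$, one has $\bigcap_U\chi(U)\neq\emptyset$. A completion of a spread $X\to Y$ is a complete spread $X'\to Y$ with an embedding $X\to X'$ over $Y$ whose image is portly in $X'$; every spread has a completion, unique up to isomorphism. A space $Z$ is semi-locally simply connected if every point $z$ has a neighborhood $U$ such that every loop in $U$ based at $z$ is null-homotopic in $Z$. The universal covering $\widetilde M^S\to M$ of $M$ possibly branched over $S$ is the completion of the spread $\widetilde{M\setminus S}\to M$, where $\widetilde{M\setminus S}$ is the universal covering of $M\setminus S$. $\Gamma(\widetilde M^S/M)$ is the group of homeomorphisms of $\widetilde M^S$ commuting with the projection to $M$. *)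

(* Defs.v *)
From HB Require Import structures.
From mathcomp Require Import all_boot all_order all_algebra.
From mathcomp Require Import all_classical reals topology normedtype.

Set Implicit Arguments.
Unset Strict Implicit.
Unset Printing Implicit Defensive.

Import Order.TTheory GRing.Theory Num.Theory.
Import numFieldNormedType.Exports.

Local Open Scope classical_set_scope.
Local Open Scope ring_scope.

(* [R] is an arbitrary model of the real numbers.  Paths and homotopies are
   total functions on [R] and [R * R]; only their values on the unit interval
   and on the unit square matter. *)
Section Homotopy.
Context (R : realType) (T : topologicalType).

Definition is_path (A : set T) (x y : T) (f : R -> T) : Prop :=
  [/\ {within `[0, 1]%classic, continuous f}, f 0 = x, f 1 = y &
      f @` `[0, 1]%classic `<=` A].

Definition path_connected (A : set T) : Prop :=
  forall x y, A x -> A y -> exists f, is_path A x y f.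

(* [f] is a loop based at [z]; the homotopy is relative to the base point. *)
Definition null_homotopic (z : T) (f : R -> T) : Prop :=
  exists H : R * R -> T,
    [/\ {within `[0, 1]%classic `*` `[0, 1]%classic, continuous H},
        forall t, t \in `[0, 1] -> H (0, t) = f t,
        forall t, t \in `[0, 1] -> H (1, t) = z &
        forall s, s \in `[0, 1] -> H (s, 0) = z /\ H (s, 1) = z].

Definition simply_connected : Prop :=
  path_connected [set: T] /\
  forall z f, is_path [set: T] z z f -> null_homotopic z f.

Definition semilocally_simply_connected : Prop :=
  forall z : T, exists2 U, nbhs z U &
    forall f, is_path U z z f -> null_homotopic z f.

Definition locally_path_connected : Prop :=
  forall (x : T) U, nbhs x U ->
    exists V, [/\ open V, V x, V `<=` U & path_connected V].

Definition first_countable : Prop :=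
  forall x : T, exists B : nat -> set T,
    (forall n, nbhs x (B n)) /\ forall U, nbhs x U -> exists n, B n `<=` U.

Definition standing_space : Prop :=
  [/\ hausdorff_space T, locally_path_connected & first_countable].

End Homotopy.

Definition locally_connected (T : topologicalType) : Prop :=
  forall (x : T) U, nbhs x U ->
    exists V, [/\ open V, V x, V `<=` U & connected V].

Definition portly (T : topologicalType) (U : set T) : Prop :=
  [/\ open U, dense U &
      forall W, open W -> connected W -> connected (W `&` U)].

Definition skeletal (T : topologicalType) (S : set T) : Prop := portly (~` S).

(* [f] maps the open set [U] homeomorphically onto the open set [f @` U]. *)
Definition open_embedding_on (T Y : topologicalType) (U : set T) (f : T -> Y) :=
  [/\ open U, {within U, continuous f}, set_inj U f &
      forall W, open W -> W `<=` U -> open (f @` W)].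

Definition is_embedding (T Y : topologicalType) (f : T -> Y) : Prop :=
  [/\ continuous f, injective f &
      forall U, open U -> exists2 V, open V & U = f @^-1` V].

Definition is_homeomorphism (T Y : topologicalType) (f : T -> Y) : Prop :=
  continuous f /\
  exists g : Y -> T, [/\ continuous g, cancel f g & cancel g f].

Record analytical_structure (G : groupType) (X : topologicalType)
    (act : G -> X -> X) : Prop := {
  analytical_connected : connected [set: X];
  analytical_locally_connected : locally_connected X;
  analytical_hausdorff : hausdorff_space X;
  act_one : forall x, act 1%g x = x;
  act_mul : forall g h x, act (g * h)%g x = act g (act h x);
  act_continuous : forall g, continuous (act g);
  act_faithful : injective act;
  act_analytical : forall g h (U : set X), open U -> U !=set0 ->
    {in U, act g =1 act h} -> act g =1 act h }.

(* A chart is a pair (domain, map); the map is a total function whose values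
   outside the domain are irrelevant. *)
Definition chart (T X : topologicalType) : Type := (set T * (T -> X))%type.

Section GXStructure.
Context (G : groupType) (X : topologicalType) (act : G -> X -> X).

(* The change of charts from [c] to [d], read on the common domain, is locally
   given by an element of the group. *)
Definition compatible (T : topologicalType) (c d : chart T X) : Prop :=
  forall x, c.1 x -> d.1 x ->
    exists g : G, \forall y \near x, d.2 y = act g (c.2 y).

Definition chart_domain (T : topologicalType) (A : set (chart T X)) : set T :=
  \bigcup_(c in A) c.1.

Definition is_atlas (T : topologicalType) (A : set (chart T X)) : Prop :=
  (forall c, A c -> open_embedding_on c.1 c.2) /\
  (forall c d, A c -> A d -> compatible c d).

Definition ae_structure (T : topologicalType) (A : set (chart T X)) : Prop :=
  is_atlas A /\ portly (chart_domain A).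

(* Extending the atlas also extends its portly domain.  A maximal atlas is
   insensitive to the values of its chart maps outside their domains, so two
   maximal structures coincide iff they are equal as sets of charts. *)
Definition maximal_ae_structure (T : topologicalType) (A : set (chart T X)) :=
  ae_structure A /\ forall B, ae_structure B -> A `<=` B -> B = A.

Definition reg (T : topologicalType) (A : set (chart T X)) : set T :=
  chart_domain A.

Definition sing (T : topologicalType) (A : set (chart T X)) : set T :=
  ~` reg A.

Definition singular_manifold (M : topologicalType) (A : set (chart M X)) :=
  [/\ locally_connected M, hausdorff_space M, @second_countable M &
      maximal_ae_structure A].

(* [f] restricts to a (G,X)-morphism from the open subset [U] of the domain of
   [A] to the open subset [V] of the domain of [B]. *)
Definition gx_morphism_on (T Y : topologicalType)
    (A : set (chart T X)) (B : set (chart Y X))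
    (U : set T) (V : set Y) (f : T -> Y) : Prop :=
  [/\ {within U, continuous f}, f @` U `<=` V &
      forall c d x, A c -> B d -> U x -> c.1 x -> d.1 (f x) ->
        exists g : G, \forall y \near x, d.2 (f y) = act g (c.2 y)].

Definition ae_morphism (T Y : topologicalType)
    (A : set (chart T X)) (B : set (chart Y X)) (f : T -> Y) : Prop :=
  continuous f /\
  exists U V, [/\ portly U, U `<=` reg A, portly V, V `<=` reg B &
                  gx_morphism_on A B U V f].

End GXStructure.

(* The components of the preimages of open sets generate the topology: since
   the component of [x] over [U `&` V] lies in the components of [x] over [U]
   and over [V], they are a subbase iff they are a base. *)
Definition spread (T Y : topologicalType) (p : T -> Y) : Prop :=
  continuous p /\
  basis [set C | exists U x, [/\ open U, (p @^-1` U) x &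
                                 C = connected_component (p @^-1` U) x]].

Definition complete_spread (T Y : topologicalType) (p : T -> Y) : Prop :=
  spread p /\
  forall (y : Y) (chi : set Y -> set T),
    let N := [set U : set Y | [/\ open U, connected U & U y]] in
    closure (range p) y ->
    (forall U, N U ->
       exists2 x, (p @^-1` U) x & chi U = connected_component (p @^-1` U) x) ->
    (forall U V, N U -> N V -> U `<=` V -> chi U `<=` chi V) ->
    \bigcap_(U in N) chi U !=set0.

Definition completion (T T' Y : topologicalType)
    (p : T -> Y) (p' : T' -> Y) (i : T -> T') : Prop :=
  [/\ complete_spread p', is_embedding i, p' \o i = p & portly (range i)].

Definition covering (E B : topologicalType) (q : E -> B) : Prop :=
  [/\ continuous q, set_surj [set: E] [set: B] q &
      forall b : B, exists V : set B, exists F : set (set E),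
        [/\ open V, V b, q @^-1` V = \bigcup_(O in F) O, trivIset F id &
            forall O, F O -> open_embedding_on O q /\ q @` O = V]].

Definition universal_covering (R : realType) (E B : topologicalType)
    (q : E -> B) : Prop :=
  covering q /\ simply_connected R E.

(* [q] is the universal covering of the subspace [M \ S], and [p] is the
   completion of [E -> M \ S -> M]. *)
Definition branched_universal_covering (R : realType)
    (M : topologicalType) (S : set M) (E Mt : topologicalType)
    (q : E -> set_type (~` S)) (i : E -> Mt) (p : Mt -> M) : Prop :=
  universal_covering R q /\ completion (set_val \o q) p i.

Definition galois_group (T Y : topologicalType) (p : T -> Y) : set (T -> T) :=
  [set h | is_homeomorphism h /\ p \o h = p].

(* Main.v *)
Require Import Defs.
From HB Require Import structures.
From mathcomp Require Import all_boot all_order all_algebra.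
From mathcomp Require Import all_classical reals topology normedtype.

(** The structure on the completed covering is forced on the image of [E], which
    is portly.  There the projection [p] is a local homeomorphism onto the
    complement of [S], which lies in the regular part of [M], so the charts of
    [M] composed with [p] form an atlas on a portly open set, that is, an a.e.
    structure.

    Both existence and uniqueness then rest on one rigidity fact
    ([transition_extends]): if two charts differ by elements of the group
    locally on the trace of a portly set on a connected open set, then they
    differ by one and the same element on the whole connected open set.  Hence
    compatibility of charts may be tested on a portly set
    ([compatible_portly]).  It follows that all charts compatible with a given
    a.e. structure are compatible with one another, so that every a.e. structure
    has a maximal extension ([maximal_extensionP]); and that any structure for
    which [p] is an a.e. morphism, being compatible with the pulled back atlas
    on a portly set, has the same maximal extension as this atlas
    ([ae_structure_pullback]).

    A deck transformation [h] satisfies [p \o h = p], so in charts it is the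
    transition between two lifts of one chart of [M] ([ae_morphism_deck]);
    preimages of portly sets under homeomorphisms are portly, which provides the
    domain on which this computation is made. *)

Import Order.TTheory GRing.Theory Num.Theory.
Import numFieldNormedType.Exports.

Local Open Scope classical_set_scope.

(** * Connectedness and portly subsets *)

Lemma path_connected_connected {R : realType} {T : topologicalType}
  {A : set T} : path_connected R A -> connected A.
Proof.
move=> pA; have [[x Ax]|A0] := pselect (A !=set0); last first.
  move=> B [y By] [C _ BC]; exfalso; apply: A0; exists y.
  by move: By; rewrite BC => -[].
have /choice[f pf] : forall y, exists f : R -> T, A y -> is_path A x y f.
  move=> y; have [Ay|nAy] := pselect (A y); last by exists (fun=> x).
  by have [f pf] := pA _ _ Ax Ay; exists f.
have I0 : `[0%R, 1%R]%classic (0%R : R) by rewrite /= in_itv /= lexx ler01.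
have I1 : `[0%R, 1%R]%classic (1%R : R) by rewrite /= in_itv /= lexx ler01.
(* [A] is the union of the paths that start at [x]. *)
have -> : A = \bigcup_(y in A) (f y @` `[0%R, 1%R]%classic).
  apply/seteqP; split => [y Ay|z [y Ay yz]].
    by have [_ _ fy _] := pf _ Ay; exists y => //; exists 1%R.
  by have [_ _ _ +] := pf _ Ay; apply.
apply: bigcup_connected.
  by exists x => y Ay; have [_ fx _ _] := pf _ Ay; exists 0%R.
move=> y Ay; apply: connected_continuous_connected.
  exact: segment_connected.
by have [] := pf _ Ay.
Qed.

Lemma locally_path_connected_connected {R : realType} {T : topologicalType} :
  locally_path_connected R T -> locally_connected T.
Proof.
move=> lT x U /lT[V [oV Vx VU pV]]; exists V; split => //.
exact: path_connected_connected pV.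
Qed.

(** A connected set stays connected when points of its closure are added, and
    the trace of the larger open set lies in the closure of that of the
    smaller one, by density. *)
Lemma portly_superset {T : topologicalType} (U V : set T) :
  portly U -> open V -> U `<=` V -> portly V.
Proof.
move=> [oU dU cU] oV UV; split => //.
  move=> O O0 oO; have [z [Oz Uz]] := dU _ O0 oO; exists z.
  by split=> //; exact: UV.
move=> W oW cW B [b Bb] [C oC BC] [F cF BF].
have /dU : (W `&` V `&` C) !=set0 by exists b; rewrite -BC.
case=> [|z [[[Wz Vz] Cz] Uz]]; first by do 2![apply: openI => //].
(* The trace on [U] of the clopen part [B] is clopen in the connected set
   [W `&` U], hence all of it. *)
have WUF : W `&` U `<=` F.
  have E : W `&` U `&` C = W `&` U.
    apply: cU => //; first by exists z.
      by exists C.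
    exists F => //; apply/seteqP; split => y [[Wy Uy] ?]; split => //.
      have : B y by rewrite BC; split=> //; split=> //; exact: UV.
      by rewrite BF => -[].
    have : B y by rewrite BF; split=> //; split=> //; exact: UV.
    by rewrite BC => -[].
  rewrite -E => y [[Wy Uy] Cy].
  have : B y by rewrite BC; split=> //; split=> //; exact: UV.
  by rewrite BF => -[].
rewrite BF; apply/seteqP; split => [y [] //|y [Wy Vy]]; split => //.
apply: contrapT => nFy.
have /dU[|t [[Wt nFt] Ut]] : (W `&` ~` F) !=set0 by exists y.
  by apply: openI => //; exact: closed_openC.
exact/nFt/WUF.
Qed.

Lemma portlyI {T : topologicalType} (U V : set T) :
  portly U -> portly V -> portly (U `&` V).
Proof.
move=> [oU dU cU] [oV dV cV]; split; first exact: openI.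
  by move=> O O0 oO; rewrite setIA; apply: dV; [exact: dU|exact: openI].
by move=> W oW cW; rewrite setIA; apply: cV; [exact: openI|exact: cU].
Qed.

Lemma portly_preimage {T : topologicalType} (h : T -> T) (U : set T) :
  is_homeomorphism h -> portly U -> portly (h @^-1` U).
Proof.
move=> [ch [g [cg hK gK]]] [oU dU cU].
have hg W : h @` W = g @^-1` W.
  apply/seteqP; split => [_ [x Wx <-]|y Wy]; first by rewrite /= hK.
  by exists (g y).
split; first by move/continuousP : ch; apply.
  move=> O [x Ox] oO; have /dU[|_ [[y Oy <-] Uy]] : (h @` O) !=set0.
  - by exists (h x); exists x.
  - by rewrite hg; move/continuousP : cg; apply.
  by exists y.
move=> W oW cW.
have -> : W `&` h @^-1` U = g @` (h @` W `&` U).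
  apply/seteqP; split => [x [Wx Ux]|_ [_ [[x Wx <-] Ux] <-]].
    by exists (h x) => //; split => //; exists x.
  by rewrite hK.
apply: connected_continuous_connected; last exact: continuous_subspaceT.
apply: cU; first by rewrite hg; move/continuousP : cg; apply.
by apply: connected_continuous_connected => //; exact: continuous_subspaceT.
Qed.

(** * Open embeddings *)

Lemma open_embedding_on_continuous {T Y : topologicalType} {U : set T}
  {f : T -> Y} {x : T} :
  open_embedding_on U f -> U x -> {for x, continuous f}.
Proof.
move=> [oU cf _ _] Ux; move: cf; rewrite continuous_open_subspace//.
by apply; rewrite inE.
Qed.

Lemma open_embedding_on_subset {T Y : topologicalType} {U W : set T}
  {f : T -> Y} :
  open_embedding_on U f -> open W -> W `<=` U -> open_embedding_on W f.
Proof.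
move=> [oU cf fI fo] oW WU; split => //.
- exact: continuous_subspaceW cf.
- by move=> x y; rewrite !inE => /WU Ux /WU Uy; apply: fI; rewrite inE.
- by move=> O oO OW; apply: fo => //; exact: subset_trans WU.
Qed.

Lemma open_embedding_on_comp {T Y Z : topologicalType} {U : set T} {V : set Y}
  {f : T -> Y} {g : Y -> Z} :
  open_embedding_on U f -> open_embedding_on V g -> U `<=` f @^-1` V ->
  open_embedding_on U (g \o f).
Proof.
move=> eU eV UV; have [oU _ fI fo] := eU; have [_ _ gI go] := eV; split => //.
- rewrite continuous_open_subspace// => x; rewrite inE => Ux.
  apply: continuous_comp; first exact: (open_embedding_on_continuous eU Ux).
  exact: (open_embedding_on_continuous eV (UV _ Ux)).
- move=> x y; rewrite !inE => Ux Uy /gI.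
  rewrite !inE => /(_ (UV _ Ux) (UV _ Uy)).
  by apply: fI; rewrite inE.
- move=> W oW WU; rewrite -image_comp; apply: go; first exact: fo.
  by move=> _ [x Wx <-]; exact/UV/WU.
Qed.

(** If an open embedding [j] lifts another one through [p], then [p] itself is
    an open embedding on the image of [j]. *)
Lemma open_embedding_on_image {E T Y : topologicalType} {O : set E}
  {j : E -> T} {p : T -> Y} :
  continuous p -> open_embedding_on O j -> open_embedding_on O (p \o j) ->
  open_embedding_on (j @` O) p.
Proof.
move=> cp ej [_ _ pjI pjo]; have [oO _ _ jo] := ej; split.
- exact: jo.
- exact: continuous_subspaceT.
- move=> _ _ /set_mem[a Oa <-] /set_mem[b Ob <-] pab.
  by congr (j _); apply: pjI; rewrite ?inE.
- move=> W oW WO.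
  have -> : p @` W = (p \o j) @` (O `&` j @^-1` W).
    apply/seteqP; split => [_ [x Wx <-]|_ [a [_ Wa] <-]]; last by exists (j a).
    by have [a Oa ax] := WO _ Wx; exists a; rewrite /= ax.
  apply: pjo; last by move=> ? [].
  rewrite openE => a [Oa Wa]; apply: filterI; first exact: open_nbhs_nbhs.
  apply: (open_embedding_on_continuous ej Oa); exact: open_nbhs_nbhs.
Qed.

Lemma embedding_open {T Y : topologicalType} {f : T -> Y} :
  is_embedding f -> open (range f) -> open_embedding_on setT f.
Proof.
move=> [cf fI fo] orf; split; first exact: openT.
- exact: continuous_subspaceT.
- by move=> x y _ _; exact: fI.
- move=> W oW _; have [V oV ->] := fo _ oW.
  suff -> : f @` (f @^-1` V) = V `&` range f by exact: openI.
  apply/seteqP; split => [_ [x Vx <-]|y [Vy [x _ fxy]]].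
    by split=> //; exists x.
  by exists x; rewrite /= ?fxy.
Qed.

Lemma set_val_open_embedding {T : topologicalType} {A : set T} :
  open A -> open_embedding_on setT (set_val : set_type A -> T).
Proof.
move=> oA; apply: embedding_open.
  split; [exact: initial_continuous|exact: val_inj|].
  by move=> U [V oV <-]; exists V.
suff -> : range (set_val : set_type A -> T) = A by [].
apply/seteqP; split => [_ [x _ <-]|x Ax]; first exact: set_valP.
by exists (SigSub (mem_set Ax)).
Qed.

(** * Rigidity of the transition elements *)

(** Over a nonempty open set inside a chart, analyticity and faithfulness leave
    at most one transition element.  The sets on which [d] is given by a fixed
    element are thus open and pairwise disjoint, so a single [g] serves on the
    connected set [N `&` D]; as this is dense in [N], the equality of continuous
    maps with values in the Hausdorff space [X] holds on [N]. *)
Lemma transition_extends {G : groupType} {X : topologicalType}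
  {act : G -> X -> X} {T : topologicalType} (N D : set T) (c d : T -> X) :
  analytical_structure act ->
  open N -> connected N -> N !=set0 -> portly D ->
  open_embedding_on N c -> {in N, continuous d} ->
  (forall y, N y -> D y -> exists g, \forall z \near y, d z = act g (c z)) ->
  exists g, forall y, N y -> d y = act g (c y).
Proof.
move=> an oN cN N0 [oD dD cD] ec cd loc.
have [_ _ _ co] := ec.
pose P (g : G) := [set y : T | \forall z \near y, d z = act g (c z)].
have oP (g : G) : open (P g) by exact: open_interior.
have Puniq (g g' : G) y : N y -> P g y -> P g' y -> g = g'.
  move=> Ny Pg Pg'; apply: (act_faithful an); apply/funext.
  pose O := (N `&` (P g `&` P g'))%classic.
  have oO : open O by apply: openI => //; exact: openI.
  apply: (act_analytical an (U := c @` O)).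
  - by apply: co => // ? [].
  - by exists (c y); exists y.
  - move=> _ /set_mem[z [_ [zg zg']] <-].
    by rewrite -(nbhs_singleton zg) -(nbhs_singleton zg').
have [y0 [Ny0 Dy0]] := dD _ N0 oN.
have [g Pg] := loc _ Ny0 Dy0; exists g.
(* The trace of [P g] is clopen in [N `&` D]: the traces of the other [P g']
   cover its complement. *)
have NDP : N `&` D `<=` P g.
  have <- : N `&` D `&` P g = N `&` D; last by move=> ? [].
  apply: cD => //; first by exists y0.
    by exists (P g).
  exists (~` \bigcup_(g' in [set g' | g' <> g]) P g').
    by apply: open_closedC; apply: bigcup_open => *; exact: oP.
  apply/seteqP; split => y [[Ny Dy] Py]; split=> //.
    by move=> [g' /= g'g Pg'y]; apply: g'g; exact: Puniq Pg'y Py.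
  have [g' Pg'] := loc _ Ny Dy.
  have [<-//|g'g] := pselect (g' = g).
  by exfalso; apply: Py; exists g'.
move=> y Ny; apply: contrapT => /eqP neq.
have := analytical_hausdorff an; rewrite open_hausdorff => /(_ _ _ neq).
move=> [[U V] /= [/set_mem Uy /set_mem Vy] [oU oV /eqP UV]].
have nU : nbhs y (d @^-1` U).
  by apply: (cd y); [rewrite inE|exact: open_nbhs_nbhs].
have nV : nbhs y ((act g \o c) @^-1` V).
  apply: continuous_comp; last exact: open_nbhs_nbhs.
    exact: (open_embedding_on_continuous ec Ny).
  exact: (act_continuous an).
have nO : nbhs y (N `&` (d @^-1` U `&` (act g \o c) @^-1` V)).
  by apply: filterI; [exact: open_nbhs_nbhs|exact: filterI].
have [||z [/interior_subset[Nz [Uz Vz]] Dz]] :=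
  dD (N `&` (d @^-1` U `&` (act g \o c) @^-1` V))°.
- by exists y.
- exact: open_interior.
have dz := nbhs_singleton (NDP _ (conj Nz Dz)).
have : (U `&` V) (d z) by split=> //; rewrite dz.
by rewrite UV.
Qed.

(** * The maximal extension of an almost everywhere structure *)

Lemma compatible_sym {G : groupType} {X : topologicalType} {act : G -> X -> X}
  {T : topologicalType} {c d : chart T X} :
  analytical_structure act -> compatible act c d -> compatible act d c.
Proof.
move=> an cd x dx cx; have [g gP] := cd _ cx dx; exists (g^-1)%g.
apply: filterS gP => y ->.
by rewrite -(act_mul an) mulVg (act_one an).
Qed.

(** Rigidity applies on a small connected neighborhood of each common point,
    including the points outside [D]. *)
Lemma compatible_portly {G : groupType} {X : topologicalType}
  {act : G -> X -> X} {T : topologicalType} {D : set T} {c d : chart T X} :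
  analytical_structure act -> locally_connected T -> portly D ->
  open_embedding_on c.1 c.2 -> open_embedding_on d.1 d.2 ->
  (forall x, D x -> c.1 x -> d.1 x ->
     exists g, \forall y \near x, d.2 y = act g (c.2 y)) ->
  compatible act c d.
Proof.
move=> an lT pD ec ed loc x cx dx.
have [oc _ _ _] := ec; have [od _ _ _] := ed.
have /lT[N [oN Nx Ncd cN]] : nbhs x (c.1 `&` d.1).
  by apply: open_nbhs_nbhs; split => //; exact: openI.
have [Nc Nd] : N `<=` c.1 /\ N `<=` d.1 by split => y /Ncd[].
have [||g gP] := transition_extends N D c.2 d.2 an oN cN (ex_intro _ x Nx) pD
  (open_embedding_on_subset ec oN Nc).
- move=> y; rewrite inE => /Nd; exact: (open_embedding_on_continuous ed).
- by move=> y Ny Dy; apply: loc => //; [exact: Nc|exact: Nd].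
exists g; have : nbhs x N by exact: open_nbhs_nbhs.
by apply: filterS.
Qed.

(** Testing charts against [A] alone, and not against each other, makes this set
    contain every atlas that contains [A]. *)
Definition maximal_extension {G : groupType} {X : topologicalType}
    (act : G -> X -> X) {T : topologicalType} (A : set (chart T X)) :
    set (chart T X) :=
  [set c | open_embedding_on c.1 c.2 /\ forall a, A a -> compatible act a c].

Lemma sub_maximal_extension {G : groupType} {X : topologicalType}
  {act : G -> X -> X} {T : topologicalType} {A : set (chart T X)} :
  is_atlas act A -> A `<=` maximal_extension act A.
Proof. by move=> [Ae Ac] c Ac'; split => [|a Aa]; [exact: Ae|exact: Ac]. Qed.

(** Two charts compatible with [A] are compatible with each other over the
    domain of [A], through any chart of [A], hence everywhere by rigidity. *)
Lemma maximal_extensionP {G : groupType} {X : topologicalType}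
  {act : G -> X -> X} {T : topologicalType} {A : set (chart T X)} :
  analytical_structure act -> locally_connected T -> ae_structure act A ->
  maximal_ae_structure act (maximal_extension act A).
Proof.
move=> an lT [atA pA]; have AB := sub_maximal_extension atA.
split; last first.
  move=> B [[Be Bc] _] sB; apply/seteqP; split => // c Bc'.
  split; first exact: Be.
  by move=> a /AB/sB Ba; exact: Bc.
split; last first.
  apply: (portly_superset _ _ pA); last by move=> x [c /AB Bc cx]; exists c.
  by apply: bigcup_open => c [[]].
split=> [c []//|c d [ec cA] [ed dA]].
apply: (compatible_portly an lT pA ec ed) => x [a Aa ax] cx dx.
have [g gP] := dA _ Aa _ ax dx.
have [k kP] := compatible_sym an (cA _ Aa) _ cx ax.
exists (g * k)%g; near=> y.
rewrite (act_mul an) -(near kP y)//; exact: (near gP y).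
Unshelve. all: by end_near. Qed.

(** * Pulling back a structure along a local homeomorphism *)

Definition pullback_atlas {X T Y : topologicalType} (A : set (chart Y X))
    (p : T -> Y) : set (chart T X) :=
  [set b | exists a, [/\ A a, open_embedding_on b.1 p, b.1 `<=` p @^-1` a.1 &
                         b.2 = a.2 \o p]].

Lemma pullback_is_atlas {G : groupType} {X : topologicalType}
  {act : G -> X -> X} {T Y : topologicalType} {A : set (chart Y X)}
  {p : T -> Y} :
  is_atlas act A -> is_atlas act (pullback_atlas A p).
Proof.
move=> [Ae Ac]; split => [[W f]|[W f] [W' f']] /=.
  move=> [a /= [Aa ep Wa ->]].
  exact: open_embedding_on_comp ep (Ae _ Aa) Wa.
move=> [a /= [Aa ep Wa ->]] [a' /= [Aa' _ Wa' ->]] x /= Wx W'x.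
have [g gP] := Ac _ _ Aa Aa' _ (Wa _ Wx) (Wa' _ W'x).
exists g; exact: (open_embedding_on_continuous ep Wx _ gP).
Qed.

Lemma pullback_chart {X T Y : topologicalType} {A : set (chart Y X)}
  {p : T -> Y} {W : set T} {a : chart Y X} {x : T} :
  continuous p -> open_embedding_on W p -> W x -> A a -> open a.1 ->
  a.1 (p x) ->
  exists b, [/\ pullback_atlas A p b, b.1 x & b.2 = a.2 \o p].
Proof.
move=> cp eW Wx Aa oa ax; have [oW _ _ _] := eW.
exists (W `&` p @^-1` a.1, a.2 \o p); split => //=.
exists a; split => //=.
apply: (open_embedding_on_subset eW); last by move=> ? [].
by apply: openI => //; move/continuousP : cp; apply.
Qed.

(** Existence: the charts of [A] composed with [p] cover the portly set [U], and
    one takes their maximal extension.  Uniqueness: if [p] is a morphism for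
    another structure, its charts are compatible with those charts over a portly
    set, hence everywhere by rigidity, so they belong to this extension. *)
Lemma ae_structure_pullback {G : groupType} {X : topologicalType}
  {act : G -> X -> X} {T Y : topologicalType} (A : set (chart Y X))
  (p : T -> Y) (U : set T) (V : set Y) :
  analytical_structure act -> locally_connected T -> is_atlas act A ->
  continuous p -> portly U -> portly V -> V `<=` reg A -> U `<=` p @^-1` V ->
  (forall x, U x -> exists2 W, W x & open_embedding_on W p) ->
  exists! B : set (chart T X),
    maximal_ae_structure act B /\ ae_morphism act B A p.
Proof.
move=> an lT atA cp pU pV VA UV Up.
pose P := pullback_atlas A p.
have atP : is_atlas act P := pullback_is_atlas atA.
have UP : U `<=` chart_domain P.
  move=> x Ux; have [W Wx eW] := Up _ Ux; have [a Aa ax] := VA _ (UV _ Ux).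
  have [oa _ _ _] := atA.1 _ Aa.
  by have [b [Pb bx _]] := pullback_chart cp eW Wx Aa oa ax; exists b.
have pP : portly (chart_domain P).
  apply: (portly_superset _ _ pU _ UP); apply: bigcup_open => c Pc.
  by have [] := atP.1 _ Pc.
have PB := sub_maximal_extension atP.
exists (maximal_extension act P); split.
  split; first exact: maximal_extensionP.
  split => //; exists U, V; split => //.
    by move=> x /UP[c /PB Bc cx]; exists c.
  split; first exact: continuous_subspaceT.
    by move=> _ [x Ux <-]; exact: UV.
  move=> c d x [_ cP] Ad Ux cx dx; have [W Wx eW] := Up _ Ux.
  have [od _ _ _] := atA.1 _ Ad.
  have [b [Pb bx bd]] := pullback_chart cp eW Wx Ad od dx.
  have [g] := compatible_sym an (cP _ Pb) _ cx bx.
  by rewrite bd; exists g.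
move=> B [[[[Be Bc] _] maxB] [_ [U' [V' [pU' _ _ _ [_ _ mor]]]]]].
apply: maxB; first by have [] := maximal_extensionP an lT (conj atP pP).
move=> c Bc'; split; first exact: Be.
move=> b Pb; apply: compatible_sym => //.
apply: (compatible_portly an lT pU' (Be _ Bc') (atP.1 _ Pb)) => x U'x cx bx.
have [a [Aa _ ba ->]] := Pb.
exact: mor Bc' Aa U'x cx (ba _ bx).
Qed.

(** Near [x] and near [h x], charts of [B] are charts of [A] composed with [p],
    up to elements of the group; since [p \o h = p] the same chart of [A] serves
    at both points, and it cancels. *)
Lemma ae_morphism_deck {G : groupType} {X : topologicalType}
  {act : G -> X -> X} {T Y : topologicalType} (B : set (chart T X))
  (A : set (chart Y X)) (p : T -> Y) (h : T -> T) :
  analytical_structure act -> ae_morphism act B A p ->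
  is_homeomorphism h -> p \o h = p -> ae_morphism act B B h.
Proof.
move=> an [cp [U [V [pU UB pV VA [_ UV mor]]]]] hh ph; have [ch _] := hh.
have phE y : p (h y) = p y by rewrite -[in RHS]ph.
split=> //; exists (U `&` h @^-1` U), U; split => //.
- by apply: portlyI => //; exact: portly_preimage.
- by move=> x [/UB].
split; first exact: continuous_subspaceT.
  by move=> _ [x [_ ?] <-].
move=> c d x Bc Bd [Ux Uhx] cx dhx.
have [a Aa ax] : reg A (p x) by apply/VA/UV; exists x.
have [g gP] := mor _ _ _ Bc Aa Ux cx ax.
have [k kP] : exists k, \forall z \near h x, a.2 (p z) = act k (d.2 z).
  by apply: mor Bd Aa Uhx dhx _; rewrite phE.
have {}kP : \forall y \near x, a.2 (p (h y)) = act k (d.2 (h y)).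
  exact: ch _ _ kP.
exists (k^-1 * g)%g; near=> y.
rewrite (act_mul an) -(near gP y)// -phE (near kP y)//.
by rewrite -(act_mul an) mulVg (act_one an).
Unshelve. all: by end_near. Qed.

(** * The branched universal covering *)

Lemma covering_local_embedding {E B : topologicalType} {q : E -> B} (e : E) :
  covering q -> exists2 O, O e & open_embedding_on O q.
Proof.
move=> [_ _ /(_ (q e))[V [F [_ Vq FV _ FP]]]].
have : (q @^-1` V) e by [].
by rewrite FV => -[O FO Oe]; exists O => //; have [] := FP _ FO.
Qed.

Theorem corollary3p14 (R : realType)
  (G : groupType) (X : topologicalType) (act : G -> X -> X)
  (M : topologicalType) (A : set (chart M X)) (S : set M)
  (E Mt : topologicalType)
  (q : E -> set_type (~` S)) (i : E -> Mt) (p : Mt -> M) :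
  standing_space R X -> standing_space R M ->
  standing_space R E -> standing_space R Mt ->
  analytical_structure act ->
  singular_manifold act A ->
  connected [set: M] ->
  skeletal S ->
  sing A `<=` S ->
  semilocally_simply_connected R (set_type (~` S)) ->
  branched_universal_covering R q i p ->
  (exists! B : set (chart Mt X),
     maximal_ae_structure act B /\ ae_morphism act B A p) /\
  (forall B : set (chart Mt X),
     maximal_ae_structure act B -> ae_morphism act B A p ->
     forall h, galois_group p h -> ae_morphism act B B h).
Proof.
move=> _ _ _ [_ lMt _] an [_ _ _ [[atA _] _]] _ skS singS _.
move=> [[covq _] [[[cp _] _] ei piq pri]].
split; last by move=> B _ mB h [hh ph]; exact: ae_morphism_deck mB hh ph.
have [oS _ _] := skS; have [ori _ _] := pri.
have piE e : p (i e) = set_val (q e) by rewrite -[LHS]/((p \o i) e) piq.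
apply: (ae_structure_pullback A p (range i) (~` S)) => //.
- exact: locally_path_connected_connected lMt.
- by move=> x nSx; apply: contrapT => nx; exact/nSx/singS.
- by move=> _ [e _ <-]; rewrite /preimage /= piE; exact: (set_valP (q e)).
move=> _ [e _ <-]; have [O Oe eO] := covering_local_embedding e covq.
exists (i @` O); first by exists e.
have [oO _ _ _] := eO.
apply: open_embedding_on_image => //.
  exact: (open_embedding_on_subset (embedding_open ei ori) oO).
by rewrite piq; exact: (open_embedding_on_comp eO (set_val_open_embedding oS)).
Qed.
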